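(* There is an $8\,CS\to1\,\mathrm{TOF\#}$ distillation protocol at distance $2$. Precisely, the Hermitian curve $y^2+y=x^3$ has exactly eight affine points $(x,y)\in\mathbb F_4^2$; let $G\in\mathbb F_4^{4\times8}$ have columns indexed by these points and rows the evaluations of $y,\ x^2,\ x,\ 1$ in this order. Binarize $G$ to an $8\times16$ binary matrix (see context), and let $H\in\mathbb F_2^{7\times16}$ be obtained by deleting its first row (the first binary row coming from $y$). Let the first five rows of $H$ be logical rows and the last two be stabilizer rows. Then $H$ has full rank; the unitary $D_H$ induced by applying $CS$ to each of the 8 pairs of adjacent physical qubits satisfies $D_H=C\,(V\otimes I)$ for some diagonal Clifford unitary $C$ on $7$ qubits and some unitary $V$ on the five logical qubits that is Clifford equivalent to $\mathrm{TOF\#}$; and the block $Z$-distance of $H$ (with respect to the 8 pairs) is $2$.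
   Context: $\mathbb F_4=\{0,1,\omega,\omega^2\}$, $\omega^2=\omega+1$, $\mathrm{tr}(\gamma)=\gamma+\gamma^2\in\mathbb F_2$. Binarization (self-dual basis $\{\omega,\omega^2\}$) replaces each entry $\gamma$ of an $\mathbb F_4$-matrix by the $2\times2$ binary block $\begin{pmatrix}\mathrm{tr}(\gamma\omega^2)&\mathrm{tr}(\gamma)\\\mathrm{tr}(\gamma)&\mathrm{tr}(\gamma\omega)\end{pmatrix}$. For a binary matrix $H\in\mathbb F_2^{m\times2n}$ with rows $\mathbf h_1,\dots,\mathbf h_m$, columns grouped into $n$ adjacent pairs, the unitary on $m$ qubits induced by applying $CS$ (phase $i^{ab}$ on $|a\rangle|b\rangle$) to each pair is $D_H|z\rangle=i^{\sum_{j=1}^nw_{2j-1}w_{2j}}|z\rangle$ where $w=\sum_az_a\mathbf h_a\bmod2\in\{0,1\}^{2n}$. With logical and stabilizer rows specified, the block $Z$-distance is the minimum, over vectors $e\in\mathbb F_2^{2n}$ orthogonal to all stabilizer rows but not to at least one logical row, of the number of pairs on which $e$ is nonzero. $\mathrm{TOF\#}$ is the five-qubit gate $|z\rangle\mapsto(-1)^{z_1z_2z_3+z_3z_4z_5}|z\rangle$. Unitaries $U,V$ are Clifford equivalent if $U=C_1VC_2$ for Clifford unitaries $C_1,C_2$. *)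

(* Defs.v *)
From HB Require Import structures.
From mathcomp Require Import all_boot all_order all_algebra.
From mathcomp Require Import all_reals.
From mathcomp Require Import mxtens complex.
Set Implicit Arguments.
Unset Strict Implicit.
Unset Printing Implicit Defensive.

Import Order.TTheory GRing.Theory Num.Theory.
Local Open Scope ring_scope.
Local Open Scope sesquilinear_scope.

(* The computational basis of n qubits is labelled by 'rV['F_2]_n; basis label
   z is the matrix index enum_rank z.  Operators act on column vectors, so the
   entry M (enum_rank x) (enum_rank y) is <x| M |y>. *)
Notation nqubit_dim n := #|{: 'rV['F_2]_n}|.
Notation qop C n := ('M[C]_(nqubit_dim n)).

Section Qubits.
Variable C : numClosedFieldType.

Definition opmx n (f : 'rV['F_2]_n -> 'rV['F_2]_n -> C) : qop C n :=
  \matrix_(i, j) f (enum_val i) (enum_val j).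

Definition diagop n (f : 'rV['F_2]_n -> C) : qop C n :=
  diag_mx (\row_i f (enum_val i)).

Definition tensop k s (A : qop C k) (B : qop C s) : qop C (k + s) :=
  opmx (fun x y : 'rV['F_2]_(k + s) =>
          A (enum_rank (lsubmx x)) (enum_rank (lsubmx y))
          * B (enum_rank (rsubmx x)) (enum_rank (rsubmx y))).

(* X^a Z^b, that is, |z> |-> (-1)^(b.z) |z + a>. *)
Definition pauliXZ n (a b : 'rV['F_2]_n) : qop C n :=
  opmx (fun x z => (x == z + a)%:R * (-1) ^+ ((b *m z^T) 0 0 : nat)).

Definition is_pauli n (P : qop C n) : Prop :=
  exists (k : nat) (a b : 'rV['F_2]_n), P = 'i ^+ k *: pauliXZ a b.

(* Conjugation is injective and the Pauli group is finite, so mapping the group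
   into itself is the same as normalizing it. *)
Definition is_clifford n (U : qop C n) : Prop :=
  U \is unitarymx /\
  forall P : qop C n, is_pauli P -> is_pauli (U *m P *m U^t*).

Definition clifford_equiv n (U V : qop C n) : Prop :=
  exists C1 C2 : qop C n,
    [/\ is_clifford C1, is_clifford C2 & U = C1 *m V *m C2].

(* The bits are read as natural numbers in {0, 1}. *)
Definition TOFsharp : qop C 5 :=
  diagop (fun z : 'rV['F_2]_5 =>
    let b (k : nat) : nat := z 0 (inord k) in
    (-1) ^+ (b 0 * b 1 * b 2 + b 2 * b 3 * b 4)%N).

(* Column 2j + c, c < 2, of a matrix with n * 2 columns is the c-th column of
   the j-th adjacent pair; it has index mxtens_index (j, c).  The exponent is a
   sum of natural numbers, not a sum in 'F_2. *)
Definition CS_op m n (H : 'M['F_2]_(m, n * 2)) : qop C m :=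
  diagop (fun z : 'rV['F_2]_m =>
    let w (j : 'I_n) (c : 'I_2) : nat := (z *m H) 0 (mxtens_index (j, c)) in
    'i ^+ (\sum_(j < n) w j ord0 * w j ord_max)%N).

End Qubits.

Definition pair_weight n (e : 'rV['F_2]_(n * 2)) : nat :=
  #|[set j : 'I_n | [exists c : 'I_2, e 0 (mxtens_index (j, c)) != 0]]|.

(* The first k rows of H are the logical rows, the last s the stabilizer rows. *)
Definition undetected_logical k s n (H : 'M['F_2]_(k + s, n * 2))
    (e : 'rV['F_2]_(n * 2)) : Prop :=
  (forall i : 'I_s, (row i (dsubmx H) *m e^T) 0 0 = 0) /\
  (exists i : 'I_k, (row i (usubmx H) *m e^T) 0 0 <> 0).

Definition has_block_Z_distance k s n (H : 'M['F_2]_(k + s, n * 2))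
    (d : nat) : Prop :=
  (exists e, undetected_logical H e /\ pair_weight e = d) /\
  (forall e, undetected_logical H e -> (d <= pair_weight e)%N).

Section Hermitian.
Variable F : finFieldType.

(* When F has four elements, x + x^2 is 0 or 1; it is returned in 'F_2. *)
Definition tr4 (x : F) : 'F_2 := (x + x ^+ 2 == 1)%:R.

Definition binblock (omega g : F) : 'M['F_2]_2 :=
  block_mx (tr4 (g * omega ^+ 2))%:M (tr4 g)%:M
           (tr4 g)%:M (tr4 (g * omega))%:M : 'M_(1 + 1).

Definition binarize (omega : F) m n (A : 'M[F]_(m, n)) :
    'M['F_2]_(m * 2, n * 2) :=
  \matrix_(i, j) binblock omega (A (mxtens_unindex i).1 (mxtens_unindex j).1)
                          (mxtens_unindex i).2 (mxtens_unindex j).2.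

Definition hermitian_points : {set F * F} :=
  [set p | p.2 ^+ 2 + p.2 == p.1 ^+ 3].

Definition evalmx n (pt : 'I_n -> F * F) : 'M[F]_(4, n) :=
  \matrix_(i, j) let: (x, y) := pt j in [:: y; x ^+ 2; x; 1]`_i.

Definition hermitianH (omega : F) (pt : 'I_8 -> F * F) :
    'M['F_2]_(5 + 2, 8 * 2) :=
  row' (ord0 : 'I_8) (binarize omega (evalmx pt)).

End Hermitian.

(* Main.v *)
Require Import Defs.
From mathcomp Require Import all_boot all_order all_algebra.
From mathcomp Require Import all_field.
From mathcomp Require Import all_reals.
From mathcomp Require Import mxtens complex.
From mathcomp Require Import zify ring.

(* Write z for the message bits.  Evaluating the binarized code at the eight
   points shows that, modulo 4, the exponent of D_H is
     3 z0 + 2 (z1 + z2 + z3 + z4) + 2 (z0 z5 + z1 z2 + z3 z4)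
       + 2 z0 (z1 z3 + z1 z4 + z2 z3).
   The first three terms give a diagonal Clifford operator built from S and CZ
   gates, and the cubic term involves logical bits only: it is the phase of
   TOF# conjugated by the CNOT circuit z |-> (z1, z3 + z4, z0, z2, z3).
   On every pair the two stabilizer rows (coming from the constant function 1)
   form an identity block, so an error orthogonal to them has its pair
   components summing to zero and cannot be supported on a single pair. *)

Set Implicit Arguments.
Unset Strict Implicit.
Unset Printing Implicit Defensive.

Import Order.TTheory GRing.Theory Num.Theory.
Local Open Scope ring_scope.
Local Open Scope sesquilinear_scope.

(** * Bits and their lifts modulo 4 *)

Lemma F2P (x : 'F_2) : x = 0 \/ x = 1.
Proof. by case: x => [[|[|[]]] //= lt]; [left|right]; exact/val_inj. Qed.

(** Reduction modulo 2 changes the integer sum of two bits by 0 or 2, and doubling turns this into a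
    multiple of 4. *)
Lemma double_F2D (s t : 'F_2) :
  (2 * ((s + t)%R : 'F_2) = 2 * s + 2 * t %[mod 4])%N.
Proof. by case: (F2P s) => ->; case: (F2P t) => ->. Qed.

(** * Phase exponents of diagonal Clifford operators *)

Section QuadraticExponent.
Variable n : nat.
Implicit Types (q : 'rV['F_2]_n -> nat) (z a : 'rV['F_2]_n).

(* The functions q for which |z> |-> i^(q z) |z> is in the Clifford group:
   their derivatives are affine, with linear part in {0, 2}. *)
Definition quadratic_exponent q : Prop :=
  forall a, exists (k : nat) (c : 'rV['F_2]_n),
    forall z, (q (z + a)%R = k + 2 * ((c *m z^T) 0 0)%R + q z %[mod 4])%N.

Lemma quadratic_exponentD q r : quadratic_exponent q -> quadratic_exponent r ->
  quadratic_exponent (fun z => q z + r z)%N.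
Proof.
move=> hq hr a; have [k [c hc]] := hq a; have [l [d hd]] := hr a.
exists (k + l)%N, (c + d) => z.
rewrite mulmxDl [(c *m z^T + d *m z^T) 0 0]mxE.
have := double_F2D ((c *m z^T) 0 0) ((d *m z^T) 0 0).
move: (hc z) (hd z); move: (nat_of_ord ((c *m z^T) 0 0)) => u.
move: (nat_of_ord ((d *m z^T) 0 0)) => v; move: (nat_of_ord (_ + _)) => w.
move: (q (z + a)) (q z) (r (z + a)) (r z) => q1 q2 r1 r2; lia.
Qed.

Lemma quadratic_exponentM m q : quadratic_exponent q ->
  quadratic_exponent (fun z => m * q z)%N.
Proof.
move=> hq; elim: m => [|m IHm].
  by move=> a; exists 0%N, 0 => z; rewrite mul0mx mxE.
move=> a; have [k [c hc]] := quadratic_exponentD hq IHm a.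
by exists k, c => z; rewrite !mulSn.
Qed.

(** The integer lift of [z_i + a_i] is [z_i + a_i - 2 a_i z_i], and -2 is 2 modulo 4. *)
Lemma quadratic_exponent_S (i : 'I_n) : quadratic_exponent (fun z => z 0 i).
Proof.
move=> a; exists (a 0 i), (a 0 i *: delta_mx 0 i) => z.
rewrite -scalemxAl -rowE !mxE.
by case: (F2P (a 0 i)) => ->; case: (F2P (z 0 i)) => ->.
Qed.

(** Expanding [2 (z_i + a_i) (z_j + a_j)] gives the constant [2 a_i a_j] and the linear part
    [2 (a_j z_i + a_i z_j)]. *)
Lemma quadratic_exponent_CZ (i j : 'I_n) :
  quadratic_exponent (fun z => 2 * (z 0%R i * z 0%R j))%N.
Proof.
move=> a; exists (2 * (a 0%R i * a 0%R j))%N.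
exists (a 0 j *: delta_mx 0 i + a 0 i *: delta_mx 0 j) => z.
rewrite mulmxDl -!scalemxAl -!rowE !mxE.
by case: (F2P (a 0 i)) => ->; case: (F2P (z 0 i)) => ->;
   case: (F2P (a 0 j)) => ->; case: (F2P (z 0 j)) => ->.
Qed.

End QuadraticExponent.

(** * Calculus of operators indexed by bit vectors; diagonal and CNOT Clifford operators *)

Section Operators.
Variable C : numClosedFieldType.

Lemma expCi_mod4 p q : (p = q %[mod 4])%N -> 'i ^+ p = 'i ^+ q :> C.
Proof.
have i4 : 'i ^+ 4 = 1 :> C by rewrite -[4%N]/(2 * 2)%N exprM sqrCi sqrrN expr1n.
by move=> e; rewrite -(expr_mod p i4) e expr_mod.
Qed.

Lemma expCi_double p : 'i ^+ (2 * p)%N = (-1) ^+ p :> C.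
Proof. by rewrite exprM sqrCi. Qed.

Section Dimension.
Variable n : nat.
Implicit Types (f g : 'rV['F_2]_n -> C) (h k : 'rV['F_2]_n -> 'rV['F_2]_n -> C).
Implicit Types (a b z : 'rV['F_2]_n) (A : 'M['F_2]_n).

Lemma sum_ord_nqubit (G : 'I_(nqubit_dim n) -> C) :
  \sum_i G i = \sum_(z : 'rV['F_2]_n) G (enum_rank z).
Proof. by rewrite (reindex enum_rank) //; exact/onW_bij/enum_rank_bij. Qed.

Lemma eq_opmx h k : h =2 k -> opmx h = opmx k.
Proof. by move=> e; apply/matrixP => i j; rewrite !mxE e. Qed.

Lemma mul_opmx h k :
  opmx h *m opmx k = opmx (fun x y => \sum_z h x z * k z y).
Proof.
apply/matrixP => i j; rewrite !mxE sum_ord_nqubit.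
by apply: eq_bigr => z _; rewrite !mxE enum_rankK.
Qed.

Lemma scale_opmx (c : C) h : c *: opmx h = opmx (fun x y => c * h x y).
Proof. by apply/matrixP => i j; rewrite !mxE. Qed.

Lemma adj_opmx h : (opmx h)^t* = opmx (fun x y => (h y x)^*).
Proof. by apply/matrixP => i j; rewrite !mxE. Qed.

Lemma opmx1 : opmx (fun x y => (x == y)%:R) = 1%:M :> qop C n.
Proof. by apply/matrixP => i j; rewrite !mxE (inj_eq enum_val_inj). Qed.

Lemma diagopE f : diagop f = opmx (fun x y => (x == y)%:R * f x).
Proof.
apply/matrixP => i j; rewrite !mxE (inj_eq enum_val_inj).
by case: eqP => [->|_]; rewrite ?mul1r ?mul0r ?mulr1n ?mulr0n.
Qed.

Lemma eq_diagop f g : f =1 g -> diagop f = diagop g.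
Proof. by move=> e; rewrite !diagopE; apply: eq_opmx => x y; rewrite e. Qed.

Lemma mul_diagop_opmx f h :
  diagop f *m opmx h = opmx (fun x y => f x * h x y).
Proof.
rewrite diagopE mul_opmx; apply: eq_opmx => x y.
rewrite (bigD1 x) //= eqxx mul1r big1 ?addr0 // => z.
by rewrite eq_sym => /negbTE ->; rewrite !mul0r.
Qed.

Lemma mul_diagop f g : diagop f *m diagop g = diagop (fun z => f z * g z).
Proof.
rewrite [in X in _ *m X]diagopE mul_diagop_opmx diagopE.
by apply: eq_opmx => x y; rewrite mulrCA.
Qed.

Lemma adj_diagop f : (diagop f)^t* = diagop (fun z => (f z)^*).
Proof.
rewrite !diagopE adj_opmx; apply: eq_opmx => x y.
by rewrite rmorphM /= conjC_nat eq_sym; case: eqP => [->|_]; rewrite ?mul0r.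
Qed.

Lemma mul_opmx_diagop h f :
  opmx h *m diagop f = opmx (fun x y => h x y * f y).
Proof.
rewrite diagopE mul_opmx; apply: eq_opmx => x y.
rewrite (bigD1 y) //= eqxx mul1r big1 ?addr0 // => z.
by move=> /negbTE ->; rewrite mul0r mulr0.
Qed.

Lemma diagop_unitary f : (forall z, f z * (f z)^* = 1) ->
  diagop f \is unitarymx.
Proof.
move=> hf; apply/unitarymxP; rewrite adj_diagop mul_diagop -opmx1 diagopE.
by apply: eq_opmx => x y; rewrite hf mulr1.
Qed.

(** Conjugation multiplies the entry of [X^a Z^b] at [(z + a, z)] by [i^(q (z + a) - q z)], which is
    [i^k (-1)^(c.z)]; the result is again a Pauli operator, with [b] replaced by [b + c]. *)
Lemma diag_clifford q : quadratic_exponent q ->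
  is_clifford (diagop (fun z => 'i ^+ q z) : qop C n).
Proof.
have ic m : 'i ^+ m * ('i ^+ m)^* = 1 :> C.
  by rewrite -normCK normrX normCi !expr1n.
move=> hq; split; first exact: diagop_unitary.
move=> P [m [a [b ->]]]; have [k [c hc]] := hq a.
exists (m + k)%N, a, (b + c).
rewrite adj_diagop -scalemxAr -scalemxAl exprD -scalerA; congr (_ *: _).
rewrite mul_diagop_opmx mul_opmx_diagop scale_opmx.
apply: eq_opmx => x z; have [->|] := eqVneq x (z + a); last first.
  by rewrite !mul0r ?mulr0 ?mul0r.
rewrite !mul1r (expCi_mod4 (hc z)) mulmxDl [(b *m z^T + _) 0 0]mxE.
rewrite -!expCi_double (expCi_mod4 (double_F2D _ _)) !exprD.
(* The phase [i^(q z)] left over from the derivative cancels against its conjugate. *)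
move: (ic (q z)); move: ('i ^+ q z) (_^*) => u v uv.
by rewrite -[RHS]mulr1 -uv; ring.
Qed.

(** Labels are row vectors, so this is [|y> |-> |y A>]; for invertible [A] it is a CNOT circuit. *)
Definition permop A : qop C n := opmx (fun x y => (x == y *m A)%:R).

Lemma eq_mulmxr A a b : A \in unitmx -> (a == b *m A) = (a *m invmx A == b).
Proof. by move=> uA; apply/eqP/eqP => [->|<-]; rewrite ?mulmxK ?mulmxKV. Qed.

Lemma adj_permop A : A \in unitmx -> (permop A)^t* = permop (invmx A).
Proof.
move=> uA; rewrite adj_opmx; apply: eq_opmx => x y.
by rewrite conjC_nat eq_mulmxr // eq_sym.
Qed.

Lemma mul_permop_opmx A h : A \in unitmx ->
  permop A *m opmx h = opmx (fun x y => h (x *m invmx A) y).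
Proof.
move=> uA; rewrite mul_opmx; apply: eq_opmx => x y.
rewrite (bigD1 (x *m invmx A)) //= mulmxKV // eqxx mul1r big1 ?addr0 // => z.
rewrite eq_sym eq_mulmxr // => /negbTE ->.
by rewrite mul0r.
Qed.

Lemma mul_opmx_permop A h : opmx h *m permop A = opmx (fun x y => h x (y *m A)).
Proof.
rewrite mul_opmx; apply: eq_opmx => x y.
rewrite (bigD1 (y *m A)) //= eqxx mulr1 big1 ?addr0 // => z.
by move=> /negbTE ->; rewrite mulr0.
Qed.

(** Conjugation sends [X^a Z^b] to [X^(a A) Z^(b A^-T)], because [b.(z A^-1) = (b A^-T).z]. *)
Lemma permop_clifford A : A \in unitmx -> is_clifford (permop A).
Proof.
move=> uA; split.
  apply/unitarymxP; rewrite adj_permop // mul_permop_opmx // -opmx1.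
  by apply: eq_opmx => x y; rewrite (inj_eq (can_inj (mulmxKV uA))).
move=> P [m [a [b ->]]]; exists m, (a *m A), (b *m (invmx A)^T).
rewrite adj_permop // -scalemxAr -scalemxAl; congr (_ *: _).
rewrite mul_permop_opmx // mul_opmx_permop; apply: eq_opmx => x z.
rewrite -eq_mulmxr // mulmxDl mulmxKV //.
by rewrite -mulmxA -trmx_mul.
Qed.

Lemma conj_permop_diagop A f : A \in unitmx ->
  permop (invmx A) *m diagop f *m permop A = diagop (fun z => f (z *m A)).
Proof.
move=> uA; rewrite !diagopE mul_permop_opmx ?unitmx_inv // mul_opmx_permop.
by apply: eq_opmx => x y; rewrite invmxK (inj_eq (can_inj (mulmxK uA))).
Qed.

End Dimension.

Lemma tensop_diagop1 k s (f : 'rV['F_2]_k -> C) :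
  tensop (diagop f) (1%:M : qop C s) = diagop (fun z => f (lsubmx z)).
Proof.
rewrite -opmx1 [RHS]diagopE diagopE; apply: eq_opmx => x y; rewrite !mxE !enum_rankK.
rewrite mulrAC -natrM mulnb; congr ((nat_of_bool _)%:R * _).
apply/andP/eqP => [[/eqP el /eqP er]|->//].
by rewrite -[x]hsubmxK -[y]hsubmxK el er.
Qed.

End Operators.

(** * Reindexing of sums *)

(** For a numeral [n], [iota 0 n.+1] is a closed list, so unlocking the big operator expands the sum
    into explicit terms. *)
Lemma sum_inord (V : nmodType) n (f : 'I_n.+1 -> V) :
  \sum_i f i = \sum_(i <- iota 0 n.+1) f (inord i).
Proof.
by rewrite -[iota 0 n.+1]/(index_iota 0 n.+1) big_mkord; apply: eq_bigr => i _; rewrite inord_val.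
Qed.

Lemma sum_pairs (V : nmodType) n (f : 'I_(n * 2) -> V) :
  \sum_i f i =
  \sum_(j < n) (f (mxtens_index (j, ord0)) + f (mxtens_index (j, ord_max))).
Proof.
transitivity (\sum_(j < n) \sum_(c < 2) f (mxtens_index (j, c))).
  rewrite pair_bigA (reindex (@mxtens_index n 2)) /=; first by apply: eq_bigr => -[].
  by exists (@mxtens_unindex n 2) => i _; rewrite (mxtens_indexK, mxtens_unindexK).
apply: eq_bigr => j _; rewrite big_ord_recl big_ord1.
by congr (_ + f (mxtens_index (j, _))); apply/val_inj.
Qed.

(** * Arithmetic of the field of four elements, binary blocks and points of the curve *)

Section FieldOfFourElements.
Variables (F : finFieldType) (omega : F).
Hypotheses (hF : #|F| = 4%N) (homega : omega ^+ 2 = omega + 1).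

Lemma pchar2_F4 : 2 \in [pchar F].
Proof. exact: (@card_finPcharP _ 2 2). Qed.

Let addxx (x : F) : x + x = 0. Proof. exact: (addrr_pchar2 pchar2_F4). Qed.

Lemma omega_neq0 : omega != 0.
Proof.
by apply/eqP => e; move: homega; rewrite e expr0n add0r => /esym/eqP; rewrite oner_eq0.
Qed.

Lemma omega_neq1 : omega != 1.
Proof.
by apply/eqP => e; move/eqP: homega; rewrite e expr1n addxx oner_eq0.
Qed.

Lemma omega1_neq0 : omega + 1 != 0.
Proof. by rewrite -homega expf_eq0 (negbTE omega_neq0). Qed.

Lemma uniq_F4 : uniq [:: 0; 1; omega; omega + 1].
Proof.
rewrite /= !inE !negb_or eq_sym oner_eq0 eq_sym omega_neq0 /=.
rewrite eq_sym omega1_neq0 eq_sym omega_neq1 /=.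
rewrite -[X in X != omega + 1]add0r (inj_eq (addIr _)) eq_sym omega_neq0 /=.
by rewrite -[X in X != omega + 1]addr0 (inj_eq (addrI _)) eq_sym oner_eq0.
Qed.

(** Four distinct elements exhaust a set of cardinality four; this makes case analysis on the
    abstract field possible. *)
Lemma mem_F4 x : x \in [:: 0; 1; omega; omega + 1].
Proof.
have /subset_cardP h : #|[:: 0; 1; omega; omega + 1]| = #|F|.
  by rewrite hF; apply/card_uniqP/uniq_F4.
by have /h -> : [:: 0; 1; omega; omega + 1] \subset F by apply/subsetP.
Qed.

Lemma F4_ind (P : F -> Prop) : P 0 -> P 1 -> P omega -> P (omega + 1) ->
  forall x, P x.
Proof.
by move=> h0 h1 h2 h3 x; move: (mem_F4 x); rewrite !inE => /or4P[]/eqP->.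
Qed.

Lemma omega1_sqr : (omega + 1) ^+ 2 = omega.
Proof.
have -> : (omega + 1) ^+ 2 = omega ^+ 2 + 1 + (1 + 1) * omega by ring.
by rewrite homega addxx mul0r addr0 -addrA addxx addr0.
Qed.

Lemma mul_omega_omega1 : omega * (omega + 1) = 1.
Proof. by rewrite mulrDr mulr1 -expr2 homega addrAC addxx add0r. Qed.

Lemma omega_cube : omega ^+ 3 = 1.
Proof. by rewrite exprS homega mul_omega_omega1. Qed.

Lemma omega1_cube : (omega + 1) ^+ 3 = 1.
Proof. by rewrite exprS omega1_sqr mulrC mul_omega_omega1. Qed.

Lemma tr4_0 : tr4 (0 : F) = 0.
Proof. by rewrite /tr4 expr0n addr0 eq_sym oner_eq0. Qed.

Lemma tr4_1 : tr4 (1 : F) = 0.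
Proof. by rewrite /tr4 expr1n addxx eq_sym oner_eq0. Qed.

Lemma tr4_omega : tr4 omega = 1.
Proof. by rewrite /tr4 homega addrA addxx add0r eqxx. Qed.

Lemma tr4_omega1 : tr4 (omega + 1) = 1.
Proof. by rewrite /tr4 omega1_sqr addrAC addxx add0r eqxx. Qed.

Definition tr4E := (tr4_0, tr4_1, tr4_omega, tr4_omega1).

(** The block is a Hankel matrix: its entry depends only on [r + c]. *)
Lemma binblockE g (r c : 'I_2) : binblock omega g r c =
  nth 0 [:: tr4 (g * omega ^+ 2); tr4 g; tr4 (g * omega)] (r + c).
Proof.
have ord1_1 (i j : 'I_1) : (i == j) = true by rewrite (ord1 i) (ord1 j) eqxx.
case: (@split_ordP 1 1 r) => i ->; case: (@split_ordP 1 1 c) => j ->.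
- apply: (etrans (block_mxEul _ _ _ _ i j)); by rewrite mxE ord1_1 (ord1 i) (ord1 j).
- apply: (etrans (block_mxEur _ _ _ _ i j)); by rewrite mxE ord1_1 (ord1 i) (ord1 j).
- apply: (etrans (block_mxEdl _ _ _ _ i j)); by rewrite mxE ord1_1 (ord1 i) (ord1 j).
- apply: (etrans (block_mxEdr _ _ _ _ i j)); by rewrite mxE ord1_1 (ord1 i) (ord1 j).
Qed.

Lemma binblock0 r c : binblock omega 0 r c = 0.
Proof.
by rewrite binblockE !mul0r !tr4E; case: r c => [[|[|[]]] // ?] [[|[|[]]] // ?].
Qed.

Lemma binblock1 r c : binblock omega 1 r c = (r == c)%:R.
Proof.
rewrite binblockE !mul1r homega !tr4E.
by case: r c => [[|[|[]]] // ?] [[|[|[]]] // ?].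
Qed.

Lemma binblock_omega r c : binblock omega omega r c = (0 < r + c)%N%:R.
Proof.
rewrite binblockE -exprS omega_cube -expr2 homega !tr4E.
by case: r c => [[|[|[]]] // ?] [[|[|[]]] // ?].
Qed.

Lemma binblock_omega1 r c : binblock omega (omega + 1) r c = (r + c < 2)%N%:R.
Proof.
rewrite binblockE [_ * omega]mulrC -homega -exprD -exprS (exprS _ 3) omega_cube mulr1.
rewrite homega !tr4E.
by case: r c => [[|[|[]]] // ?] [[|[|[]]] // ?].
Qed.

(** For [x = 0] the equation leaves [y] in {0, 1}; for [x] nonzero, [x^3 = 1] forces [y] to be
    [omega] or [omega + 1]. *)
Definition hermitian_seq : seq (F * F) :=
  [:: (0, 0); (0, 1); (1, omega); (1, omega + 1); (omega, omega);
      (omega, omega + 1); (omega + 1, omega); (omega + 1, omega + 1)].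

Lemma hermitian_seq_uniq : uniq hermitian_seq.
Proof.
move: uniq_F4; rewrite /= !inE !negb_or !xpair_eqE !eqxx /= !andbT.
by move=> /and3P[/and3P[/negbTE-> /negbTE-> /negbTE->] /andP[/negbTE-> /negbTE->] /negbTE->].
Qed.

Lemma hermitian_pointsE : hermitian_points F =i hermitian_seq.
Proof.
move=> [x y]; rewrite inE /= !inE !xpair_eqE.
have := uniq_F4; rewrite /= !inE !negb_or andbT.
move=> /and3P[/and3P[n1 n2 n3] /andP[n4 n5] n6].
have [m1 m2 m3] : [/\ 1 != 0 :> F, omega != 0 & omega + 1 != 0]
  by split; rewrite eq_sym.
have [m4 m5 m6] : [/\ omega != 1, omega + 1 != 1 & omega + 1 != omega]
  by split; rewrite eq_sym.
have oo : omega + 1 + omega = 1 by rewrite addrAC addxx add0r.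
have oo' : omega + (omega + 1) = 1 by rewrite addrC.
elim/F4_ind: x; elim/F4_ind: y;
  rewrite ?expr0n ?expr1n ?homega ?omega1_sqr ?omega_cube ?omega1_cube ?addxx ?addr0 ?oo ?oo';
  by rewrite ?eqxx ?(negbTE n1, negbTE n2, negbTE n3, negbTE n4, negbTE n5, negbTE n6,
    negbTE m1, negbTE m2, negbTE m3, negbTE m4, negbTE m5, negbTE m6) ?eqxx.
Qed.

End FieldOfFourElements.

(** * The binarized Hermitian code: rank, phase exponent and distance *)

Section HermitianCode.
Variables (F : finFieldType) (omega : F).
Hypotheses (hF : #|F| = 4%N) (homega : omega ^+ 2 = omega + 1).

Lemma card_hermitian_points : #|hermitian_points F| = 8%N.
Proof.
rewrite (eq_card (hermitian_pointsE hF homega)).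
exact/card_uniqP/(hermitian_seq_uniq hF homega).
Qed.

(** The pair of entries of [z *m H] at the point [p]. The coordinate [p.2] contributes one term
    only, its first binary row being deleted. *)
Definition codeword (z : 'I_7 -> 'F_2) (p : F * F) (c : 'I_2) : 'F_2 :=
  let B g r := binblock omega g r c in
  z (inord 0) * B p.2 ord_max
  + (z (inord 1) * B (p.1 ^+ 2) ord0 + z (inord 2) * B (p.1 ^+ 2) ord_max)
  + (z (inord 3) * B p.1 ord0 + z (inord 4) * B p.1 ord_max)
  + (z (inord 5) * B 1 ord0 + z (inord 6) * B 1 ord_max).

Variable pt : 'I_8 -> F * F.
Hypotheses (pt_inj : injective pt)
  (pt_im : [set pt j | j : 'I_8] = hermitian_points F).
Let H := hermitianH omega pt.

(** The shift [i.+1] accounts for the deleted row 0. *)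
Lemma hermitianHE i j c : H i (mxtens_index (j, c)) =
  binblock omega [:: (pt j).2; (pt j).1 ^+ 2; (pt j).1; 1]`_(i.+1 %/ 2)
           (inord (i.+1 %% 2)) c.
Proof.
have e a : evalmx pt a j = [:: (pt j).2; (pt j).1 ^+ 2; (pt j).1; 1]`_a.
  by rewrite mxE; case: (pt j).
rewrite [LHS]mxE [LHS]mxE mxtens_indexK e; congr (binblock _ _ _ _).
by apply/val_inj; rewrite /= inordK ?ltn_pmod.
Qed.

Lemma mulmx_hermitianH (z : 'rV_7) j c :
  (z *m H) 0 (mxtens_index (j, c)) = codeword (z 0) (pt j) c.
Proof.
rewrite mxE sum_inord unlock /= !hermitianHE !inordK //= /codeword.
have -> : inord 0 = ord0 :> 'I_2 by apply/val_inj; rewrite /= inordK.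
have -> : inord 1 = ord_max :> 'I_2 by apply/val_inj; rewrite /= inordK.
by rewrite addr0 !addrA.
Qed.

(** Since [pt] numbers the points bijectively, the order of the columns does not matter and the
    explicit list can replace it. *)
Lemma sum_hermitian_points (V : nmodType) (f : F * F -> V) :
  \sum_j f (pt j) = \sum_(p <- hermitian_seq omega) f p.
Proof.
rewrite [RHS]big_uniq ?(hermitian_seq_uniq hF homega) //=.
transitivity (\sum_(p in hermitian_points F) f p); last first.
  by apply: eq_bigl; apply: hermitian_pointsE.
rewrite -pt_im.
by rewrite big_imset //= => i j _ _; apply: pt_inj.
Qed.

Lemma pt_surj p : p \in hermitian_seq omega -> exists j, pt j = p.
Proof.
by rewrite -(hermitian_pointsE hF homega) -pt_im => /imsetP[j _ ->]; exists j.
Qed.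


Lemma hermitianH_row_free : row_free H.
Proof.
apply: inj_row_free => z z0.
have : all (fun p => (codeword (z 0) p ord0 == 0) && (codeword (z 0) p ord_max == 0))
           (hermitian_seq omega).
  by apply/allP => p /pt_surj[j <-]; rewrite -2!mulmx_hermitianH z0 !mxE eqxx.
rewrite /codeword /= !(expr0n, expr1n, homega, omega1_sqr hF homega) /=.
rewrite !(binblock0, binblock1 hF homega, binblock_omega hF homega,
          binblock_omega1 hF homega) /= !(mulr0, mulr1, add0r, addr0) => w0.
(* With the seven bits gathered in a closed list, the claim is settled by checking all 128
   messages. *)
suff e : [:: z 0 (inord 0); z 0 (inord 1); z 0 (inord 2); z 0 (inord 3);
             z 0 (inord 4); z 0 (inord 5); z 0 (inord 6)] = nseq 7 0.
  apply/rowP => i; rewrite mxE -(inord_val i).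
  have := congr1 (fun s => s`_i) e; rewrite nth_nseq ltn_ord => <-.
  by case: i => [[|[|[|[|[|[|[|]]]]]]]].
move: w0; case: (F2P (z 0 (inord 0))) => ->; case: (F2P (z 0 (inord 1))) => ->;
case: (F2P (z 0 (inord 2))) => ->; case: (F2P (z 0 (inord 3))) => ->;
case: (F2P (z 0 (inord 4))) => ->; case: (F2P (z 0 (inord 5))) => ->;
by case: (F2P (z 0 (inord 6))) => ->.
Qed.

(** Verified on all 128 messages. The cubic terms are grouped, with [b 3 + b 4] taken in ['F_2], to
    match the bits produced by [cnot_mx]. *)
Lemma CS_exponentE (z : 'rV['F_2]_7) :
  let b k : 'F_2 := z 0 (inord k) in
  (\sum_j (z *m H)%R 0%R (mxtens_index (j, ord0)) * (z *m H)%R 0%R (mxtens_index (j, ord_max))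
   = (3 * b 0 + 2 * b 1 + 2 * b 2 + 2 * b 3 + 2 * b 4
      + 2 * (b 0 * b 5) + 2 * (b 1 * b 2) + 2 * (b 3 * b 4))
     + 2 * (b 1 * (b 3 + b 4)%R * b 0 + b 0 * b 2 * b 3) %[mod 4])%N.
Proof.
move=> b; rewrite (eq_bigr (fun j => codeword (z 0%R) (pt j) ord0
    * codeword (z 0%R) (pt j) ord_max)%N); last first.
  by move=> j _; rewrite !mulmx_hermitianH.
rewrite (sum_hermitian_points (fun p => codeword (z 0%R) p ord0
    * codeword (z 0%R) p ord_max)%N) unlock.
rewrite /codeword /= !(expr0n, expr1n, homega, omega1_sqr hF homega) /=.
rewrite !(binblock0, binblock1 hF homega, binblock_omega hF homega,
          binblock_omega1 hF homega) /= !(mulr0, mulr1, add0r, addr0).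
rewrite /b; case: (F2P (z 0 (inord 0))) => ->; case: (F2P (z 0 (inord 1))) => ->;
case: (F2P (z 0 (inord 2))) => ->; case: (F2P (z 0 (inord 3))) => ->;
case: (F2P (z 0 (inord 4))) => ->; case: (F2P (z 0 (inord 5))) => ->;
by case: (F2P (z 0 (inord 6))) => ->.
Qed.

(** The constant 1 binarizes to the identity block, so each stabilizer row selects one component of
    every pair. *)
Lemma stabilizer_mul (e : 'rV_(8 * 2)) (i : 'I_2) :
  (row i (dsubmx (H : 'M_(5 + 2, 8 * 2))) *m e^T) 0 0 =
  \sum_j e 0 (mxtens_index (j, i)).
Proof.
rewrite mxE sum_pairs; apply: eq_bigr => j _.
rewrite [row _ _ _ _]mxE [dsubmx _ _ _]mxE [e^T _ _]mxE.
rewrite [X in _ + X * _]mxE [dsubmx _ _ _]mxE [e^T _ _]mxE.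
rewrite !hermitianHE.
have -> : ((rshift 5 i).+1 %/ 2 = 3)%N by case: i => [[|[|[]]]].
have -> : inord ((rshift 5 i).+1 %% 2) = i.
  by apply/val_inj; rewrite /= inordK ?ltn_pmod //; case: i => [[|[|[]]]].
rewrite /= !(binblock1 hF homega).
by case: i => [[|[|[]]] // lt]; rewrite ?mul1r ?mul0r ?addr0 ?add0r;
   congr (e 0 (mxtens_index (_, _))); apply/val_inj.
Qed.

Lemma hermitianH_distance : has_block_Z_distance (H : 'M_(5 + 2, 8 * 2)) 2.
Proof.
split; last first.
  move=> e [stab [l le]]; rewrite ltnNge; apply/negP => wt_le1.
  apply: le; suff -> : e = 0 by rewrite trmx0 mulmx0 mxE.
  (* Weight at most 1 means that all nonzero entries of [e] lie in a single pair. *)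
  have nz j j' c c' : e 0 (mxtens_index (j, c)) != 0 ->
      e 0 (mxtens_index (j', c')) != 0 -> j = j'.
    move=> nz nz'; apply: (card_le1_eqP wt_le1); rewrite inE; apply/existsP.
      by exists c'.
    by exists c.
  apply/rowP => k; rewrite mxE -[k]mxtens_unindexK.
  case: (mxtens_unindex k) => j c; apply/eqP/negPn/negP => ejc.
  (* The sum given by stabilizer row [c] then reduces to the one entry [e] at [(j, c)], which must
     vanish. *)
  have := stab c; rewrite stabilizer_mul (bigD1 j) //= big1 ?addr0.
    by move=> e0; rewrite e0 eqxx in ejc.
  move=> j' nj; apply/eqP; apply: contraNT nj => ej'.
  by rewrite (nz _ _ _ _ ej' ejc).
(* A weight-2 error: the second component is flipped at two points with equal [x] and different [y].
   The stabilizers see an even number of flips, while a row coming from [y] separates the points. *)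
have [j1 e1] : exists j, pt j = (0, 0) by apply: pt_surj; rewrite !inE eqxx.
have [j2 e2] : exists j, pt j = (0, 1) by apply: pt_surj; rewrite !inE eqxx orbT.
have j12 : j1 != j2.
  apply/eqP => ej; move: e1; rewrite ej e2 => -[] /eqP; rewrite oner_eq0 //.
pose e : 'rV['F_2]_(8 * 2) := \row_k
  (((mxtens_unindex k).1 \in [set j1; j2]) && ((mxtens_unindex k).2 == ord_max))%:R.
have eE j c : e 0 (mxtens_index (j, c)) = ((j \in [set j1; j2]) && (c == ord_max))%:R.
  by rewrite mxE mxtens_indexK.
exists e; split; last first.
  rewrite /pair_weight -[RHS](_ : #|[set j1; j2]| = 2); last by rewrite cards2 j12.
  apply: eq_card => j; rewrite inE; apply/existsP/idP => [[c]|jin].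
    by rewrite eE; case: (j \in _).
  by exists ord_max; rewrite eE jin.
have sum12 (f : 'I_8 -> 'F_2) : \sum_j f j * (j \in [set j1; j2])%:R = f j1 + f j2.
  rewrite (bigD1 j1) //= (bigD1 j2) 1?eq_sym //= !inE !eqxx orbT !mulr1 big1 ?addr0 //.
  by move=> j /andP[/negbTE n1 /negbTE n2]; rewrite !inE n1 n2 mulr0.
split.
  move=> i; rewrite stabilizer_mul.
  rewrite (eq_bigr (fun j => (i == ord_max)%:R * (j \in [set j1; j2])%:R)).
    by rewrite sum12; case: (i == ord_max); apply/eqP.
  by move=> j _; rewrite eE -natrM mulnb andbC.
(* Row 0 of [H] is the second binary row of [y]; its second components at the two points are 0 and
   1. *)
exists ord0; rewrite mxE sum_pairs.
rewrite (eq_bigr (fun j => H 0 (mxtens_index (j, ord_max)) * (j \in [set j1; j2])%:R)).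
  rewrite sum12 !hermitianHE /= e1 e2 binblock0 (binblock1 hF homega).
  by rewrite -val_eqE /= inordK.
move=> j _; rewrite [row _ _ _ _]mxE [usubmx _ _ _]mxE [e^T _ _]mxE.
rewrite [X in _ + X * _]mxE [usubmx _ _ _]mxE [e^T _ _]mxE !eE andbF mulr0 add0r andbT.
by congr (H _ _ * _); apply/val_inj.
Qed.

End HermitianCode.

(** * The CNOT circuit relating the cubic phase to TOF#, and the conclusion *)

Definition cnot_mx : 'M['F_2]_5 :=
  \matrix_(i, j) ((i : nat, j : nat) \in
     [:: (1, 0); (3, 1); (4, 1); (0, 2); (2, 3); (3, 4)]%N)%:R.

Lemma mulmx_cnot_mx (z : 'rV_5) (k : nat) : (k < 5)%N ->
  let b l := z 0 (inord l) in
  (z *m cnot_mx) 0 (inord k) = [:: b 1; b 3 + b 4; b 0; b 2; b 3]`_k.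
Proof.
move=> k5 b; rewrite mxE sum_inord unlock /= !mxE !inordK //.
by case: k k5 => [|[|[|[|[]]]]] //= _; rewrite !(mulr0, mulr1, add0r, addr0).
Qed.

(** Bits 0 to 3 appear unchanged in the output, and bit 4 is recovered from [b 3 + b 4]. *)
Lemma cnot_mx_unit : cnot_mx \in unitmx.
Proof.
rewrite -row_free_unit; apply: inj_row_free => z z0.
have e k : (k < 5)%N -> [:: z 0 (inord 1); z 0 (inord 3) + z 0 (inord 4);
    z 0 (inord 0); z 0 (inord 2); z 0 (inord 3)]`_k = 0.
  by move=> k5; rewrite -mulmx_cnot_mx // z0 mxE.
have /= e1 := e 0 isT; have /= e34 := e 1 isT; have /= e0 := e 2 isT.
have /= e2 := e 3 isT; have /= e3 := e 4 isT.
move: e34; rewrite e3 add0r => e4.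
apply/rowP => i; rewrite mxE -(inord_val i).
by case: i => [[|[|[|[|[|]]]]]].
Qed.

Theorem mainTheorem17 (R : realType) (F : finFieldType) (omega : F)
    (hF : #|F| = 4%N) (homega : omega ^+ 2 = omega + 1) :
  #|hermitian_points F| = 8%N /\
  forall pt : 'I_8 -> F * F,
    injective pt -> [set pt j | j : 'I_8] = hermitian_points F ->
    let H := hermitianH omega pt in
    [/\ \rank H = 7%N,
        exists (K : qop (complex R) 7) (V : qop (complex R) 5),
          [/\ is_clifford K, is_diag_mx K, V \is unitarymx,
              clifford_equiv V (TOFsharp (complex R))
            & CS_op (complex R) H = K *m tensop V (1%:M : qop (complex R) 2)]
      & has_block_Z_distance H 2].
Proof.
split; first exact: card_hermitian_points homega.
move=> pt pt_inj pt_im H; split; last exact: hermitianH_distance.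
  exact: eqP (hermitianH_row_free hF homega pt_im).
(* [q] is the Clifford part of the exponent, and [t] is the exponent of TOF#. *)
pose b (z : 'rV['F_2]_7) k : nat := z 0 (inord k).
pose q z := (3 * b z 0 + 2 * b z 1 + 2 * b z 2 + 2 * b z 3 + 2 * b z 4
      + 2 * (b z 0 * b z 5) + 2 * (b z 1 * b z 2) + 2 * (b z 3 * b z 4))%N.
pose t (z : 'rV['F_2]_5) : nat :=
  let b (k : nat) : nat := z 0 (inord k) in
  (b 0 * b 1 * b 2 + b 2 * b 3 * b 4)%N.
exists (diagop (fun z => 'i ^+ q z)), (diagop (fun z => (-1) ^+ t (z *m cnot_mx))).
split.
- apply: diag_clifford.
  (* Seven additions join the eight terms of [q]; the term [3 * b z 0] remains for the last line. *)
  do 7 (apply: quadratic_exponentD;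
    last by [apply/quadratic_exponentM/quadratic_exponent_S
            |apply: quadratic_exponent_CZ]).
  exact/quadratic_exponentM/quadratic_exponent_S.
- exact: diag_mx_is_diag.
- by apply: diagop_unitary => z; rewrite rmorphXn rmorphN1 /= -exprMn mulrNN mulr1 expr1n.
- exists (permop _ (invmx cnot_mx)), (permop _ cnot_mx).
  split; [| |by rewrite conj_permop_diagop ?cnot_mx_unit].
    by apply: permop_clifford; rewrite unitmx_inv cnot_mx_unit.
  exact/permop_clifford/cnot_mx_unit.
rewrite tensop_diagop1 mul_diagop; apply: eq_diagop => z.
have bE k : (k < 5)%N -> (lsubmx z : 'rV_5) 0 (inord k) = z 0 (inord k).
  move=> k5; rewrite mxE; congr (z 0 _); apply/val_inj.
  by rewrite /= !inordK // (leq_trans k5).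
apply: etrans (expCi_mod4 _ (CS_exponentE hF homega pt_inj pt_im z)) _.
by rewrite exprD expCi_double /t !mulmx_cnot_mx //= !bE.
Qed.
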